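(* Let $N\ge1$ and consider the $1$-parameter family $\mathcal{X}_t:=\{f_t(\mathbf{x})=0\}$, $t\in\mathbb{C}$, with $$f_0(\mathbf{x}):=\sum_{i=1}^{N-1}x_i^2+x_N^3+x_{N+1}^4,\qquad f_t(\mathbf{x}):=f_0(\mathbf{x})+t^2x_N^2+2t\,x_Nx_{N+1}^2 .$$ Then $\mathcal{X}_0$ has an isolated $E_6$ singular point (at the origin) and, for generic $t\in\mathbb{C}$, $\mathcal{X}_t$ admits the unique singular point $\mathbf{0}\in f_t^{-1}(0)$, which is of type $A_5$.
   Context: $\mathbf{x}=(x_1,\ldots,x_{N+1})\in\mathbb{C}^{N+1}$. An isolated hypersurface singularity is of type $A_m$ (resp. $E_6$) if it is equivalent, up to a local biholomorphic change of coordinates, to $\sum_{i=1}^Nx_i^2+x_{N+1}^{m+1}=0$ (resp. $\sum_{i=1}^{N-1}x_i^2+x_N^3+x_{N+1}^4=0$) at the origin. *)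

(* Defs.v *)
From HB Require Import structures.
From mathcomp Require Import all_boot all_order all_algebra.
From mathcomp Require Import complex.
From mathcomp Require Import all_classical all_reals all_analysis.

Set Implicit Arguments.
Unset Strict Implicit.
Unset Printing Implicit Defensive.

Import Order.TTheory GRing.Theory Num.Theory.
Import numFieldNormedType.Exports.

Local Open Scope classical_set_scope.
Local Open Scope ring_scope.

(* Bundled as a number field so that it is a normed module over itself;
   differentiability over it is complex differentiability. *)
Definition Cplx (R : realType) : numClosedFieldType := complex R.

(* The coordinates x_1, ..., x_{N+1} are x 0 0, ..., x 0 ord_max. *)
Notation "''AC[' R ]_ N" := 'rV[Cplx R]_(N.+1)
  (at level 8, N at level 2, format "''AC[' R ]_ N").

Definition holomorphic_on (R : realType) (V W : normedModType (Cplx R))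
  (U : set V) (f : V -> W) : Prop :=
  open U /\ forall x, U x -> differentiable f x.

Definition biholomorphism (R : realType) (V W : normedModType (Cplx R))
  (U : set V) (U' : set W) (phi : V -> W) (psi : W -> V) : Prop :=
  [/\ holomorphic_on U phi,
      holomorphic_on U' psi,
      forall x, U x -> U' (phi x) /\ psi (phi x) = x &
      forall y, U' y -> U (psi y) /\ phi (psi y) = y].

(* The germ at p of the hypersurface f = 0 is carried by a biholomorphism to
   the germ at 0 of g = 0.  The nowhere vanishing factor u expresses that the
   equations f and g o phi define the same hypersurface (with its structure,
   i.e. generate the same ideal of germs), not only the same set of zeros. *)
Definition hypersurface_germ_equiv (R : realType) (N : nat)
  (f : 'AC[R]_N -> Cplx R) (p : 'AC[R]_N) (g : 'AC[R]_N -> Cplx R) : Prop :=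
  exists (U U' : set 'AC[R]_N) (phi psi : 'AC[R]_N -> 'AC[R]_N)
         (u : 'AC[R]_N -> Cplx R),
    [/\ U p, phi p = 0, biholomorphism U U' phi psi, holomorphic_on U u &
        forall x, U x -> u x != 0 /\ f x = u x * g (phi x)].

Definition singular_points (R : realType) (N : nat)
  (f : 'AC[R]_N -> Cplx R) : set 'AC[R]_N :=
  [set x | f x = 0 /\ is_diff x f (cst 0)].

Definition isolated_singular_point (R : realType) (N : nat)
  (f : 'AC[R]_N -> Cplx R) (p : 'AC[R]_N) : Prop :=
  singular_points f p /\ \forall x \near p, singular_points f x -> x = p.

Definition A_form (R : realType) (N m : nat) (x : 'AC[R]_N) : Cplx R :=
  \sum_(i < N.+1 | (i < N)%N) x 0 i ^+ 2 + x 0 ord_max ^+ m.+1.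

(* inord N.-1 is the index of x_N, provided 1 <= N. *)
Definition E6_form (R : realType) (N : nat) (x : 'AC[R]_N) : Cplx R :=
  \sum_(i < N.+1 | (i < N.-1)%N) x 0 i ^+ 2
  + x 0 (inord N.-1) ^+ 3 + x 0 ord_max ^+ 4.

Definition of_type_A (R : realType) (N m : nat)
  (f : 'AC[R]_N -> Cplx R) (p : 'AC[R]_N) : Prop :=
  isolated_singular_point f p /\ hypersurface_germ_equiv f p (@A_form R N m).

Definition of_type_E6 (R : realType) (N : nat)
  (f : 'AC[R]_N -> Cplx R) (p : 'AC[R]_N) : Prop :=
  isolated_singular_point f p /\ hypersurface_germ_equiv f p (@E6_form R N).

Definition f_ (R : realType) (N : nat) (t : Cplx R) (x : 'AC[R]_N) : Cplx R :=
  E6_form x + t ^+ 2 * x 0 (inord N.-1) ^+ 2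
  + 2 * t * x 0 (inord N.-1) * x 0 ord_max ^+ 2.

(* P holds on a nonempty Zariski-open subset of the affine line. *)
Definition generically (R : realType) (P : Cplx R -> Prop) : Prop :=
  exists2 q : {poly Cplx R}, q != 0 & forall t, q.[t] != 0 -> P t.

(* Main.v *)
Require Import Defs.
From mathcomp Require Import all_boot all_order all_algebra.
From mathcomp Require Import complex.
From mathcomp Require Import all_classical all_reals all_analysis.
From mathcomp Require Import ring.

Import Order.TTheory GRing.Theory Num.Theory.
Import numFieldNormedType.Exports.
Local Open Scope classical_set_scope.
Local Open Scope ring_scope.

(** Write a and b for the last two coordinates, so that f_t is the sum of the
    squares of the others plus g = a^3 + (t a + b^2)^2.

    Singular points.  At a common zero of f_t and its gradient the squared
    coordinates vanish, and the derivative of g in b gives t a + b^2 = 0 or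
    b = 0.  In the first case the other summand a^3 of g vanishes too; in the
    second one a is a common root of a^3 + t^2 a^2 and of its derivative, hence
    0 ([critical_point_eq0]).  This holds for all t, and it settles the E_6 case
    t = 0 since f_0 is the normal form itself.

    Type A_5.  Let t <> 0.  The curve g = 0 is parametrized by a = - s^2,
    b^2 = s^2 (t + s), hence, with s = m^2 - t, by a = - (m^2 - t)^2 and
    b = m^3 - t m.  So for a given b the three roots of the cubic g in a come
    from the three roots m of m^3 - t m = b.  The root m close to 0 gives a root
    a of g which stays close to - t^2, away from the origin.  The other two
    roots of g come from the other two solutions of m^3 - t m = b, whose
    symmetric functions are polynomials in m; this yields the identity
    ([family_factorization])
      g = (a + (m^2 - t)^2) (A^2 + k m^6)
    with A = a + t m^2 - m^4 / 2 and k = 3 m^2 / 4 - t.  The first factor and k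
    are units at the origin.  Hence, if u denotes their product,
      f_t = u (sum_i (x_i / sqrt u)^2 + (A / sqrt k)^2 + m^6),
    which is the A_5 normal form in the coordinates x_i / sqrt u, A / sqrt k
    and m.  In the other direction b and then a are explicit functions of m and
    A, so that this change of coordinates is biholomorphic
    ([family_equiv_A5]).

    What analysis this needs reduces to a holomorphic local inverse of the
    polynomials m^3 - t m at 0 and m^2 at a nonzero point.  For a polynomial
    over an algebraically closed field no fixed point argument is needed:
    factoring p - w shows that w has a preimage near a when w is near p(a), and
    the divided difference of p shows that it is unique and depends
    differentiably on w ([poly_local_inverse]). *)

(** * Differentiability of coordinate expressions *)

Lemma differentiable_pow {K : numFieldType} {V : normedModType K} (f : V -> K)
    n x :
  differentiable f x -> differentiable (fun y => f y ^+ n) x.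
Proof.
rewrite -[fun y => _]exprfctE => df; case: n => [|n].
  exact: (differentiable_cst (1 : K)).
exact: differentiableX.
Qed.

Lemma differentiable_inv {K : numFieldType} {V : normedModType K} (f : V -> K)
    x :
  differentiable f x -> f x != 0 -> differentiable (fun y => (f y)^-1) x.
Proof. exact: differentiableV. Qed.

Lemma differentiable_horner {K : numFieldType} (p : {poly K}) (x : K) :
  differentiable (fun z : K => p.[z]) x.
Proof.
elim/poly_ind: p => [|p c IHp].
  rewrite (_ : (fun z => _) = cst 0); first exact: differentiable_cst.
  by apply/funext => z; rewrite horner0.
rewrite (_ : (fun z => _) = (fun z => p.[z]) * id + cst c); last first.
  by apply/funext => z; rewrite hornerMXaddC.
by apply: differentiableD => //; apply: differentiableM.
Qed.

Lemma differentiable_row {K : numFieldType} {V : normedModType K} {n}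
  (f : V -> 'rV[K]_n.+1) (x : V) :
  (forall i, differentiable (fun v => f v 0 i) x) -> differentiable f x.
Proof.
move=> df.
rewrite (_ : f = \sum_(i < n.+1)
    (fun v => f v 0 i *: (delta_mx 0 i : 'rV[K]_n.+1))).
  by apply: differentiable_sum => i; exact: differentiableZl.
by apply/funext => v; rewrite fct_sumE -row_sum_delta.
Qed.

Ltac differentiable_tac := repeat first
  [ assumption | apply: differentiable_coord | apply: differentiable_cst
  | apply: differentiableB | apply: differentiableD
  | apply: differentiableM | apply: differentiable_pow ].

Lemma is_derive_coord {K : numFieldType} {n} (x v : 'rV[K]_n.+1) (i : 'I_n.+1) :
  is_derive x v (fun y : 'rV[K]_n.+1 => y 0 i) (v 0 i).
Proof.
apply: DeriveDef; first exact/diff_derivable/differentiable_coord.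
rewrite /derive; apply: cvg_lim => //.
have : cst (v 0 i) h @[h --> (0 : K)^'] --> v 0 i by exact: cvg_cst.
apply: cvg_trans; apply: near_eq_cvg; near=> h => /=.
rewrite !mxE addrK [in RHS]/GRing.scale /= mulKf //.
by near: h; exact: (@nbhs_dnbhs_neq K 0).
Unshelve. all: by end_near. Qed.

Lemma open_setI_preimage {K : numFieldType} {V W : normedModType K}
    (A : set V) (g : V -> W) (B : set W) :
  open A -> (forall x, A x -> differentiable g x) -> open B ->
  open (A `&` g @^-1` B).
Proof.
move=> oA dg oB; rewrite openE => x [Ax Bgx]; apply: filterI.
  exact: open_nbhs_nbhs.
apply: (differentiable_continuous (dg x Ax)).
exact: open_nbhs_nbhs.
Qed.

(** * Local inverses of polynomials *)

(** The function q extends the difference quotient of p continuously to the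
    diagonal: it is used both to bound p(x) - p(y) from below, where p' does not
    vanish, and to compute the derivative of the inverse of p. *)
Lemma divided_difference {K : numFieldType} (p : {poly K}) :
  exists q : K * K -> K,
    [/\ continuous q, forall x y, p.[x] - p.[y] = (x - y) * q (x, y)
      & forall x, q (x, x) = p^`().[x]].
Proof.
elim/poly_ind: p => [|p c [q [q_cont qE q_diag]]].
  exists (cst 0); split => [|x y|x]; first exact: cst_continuous.
    by rewrite !horner0 subrr mulr0.
  by rewrite deriv0 horner0.
exists (fun z => p.[z.1] + z.2 * q z); split => [z|x y|x] /=.
- apply: cvgD; last by apply: cvgM; [exact: cvg_snd|exact: q_cont].
  apply: (continuous_comp (f := fst) (g := fun x => p.[x])).
    exact: cvg_fst.
  exact/differentiable_continuous/differentiable_horner.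
- rewrite !hornerMXaddC.
  transitivity ((x - y) * p.[x] + y * (p.[x] - p.[y])); first by ring.
  by rewrite qE; ring.
- by rewrite derivMXaddC hornerD hornerM hornerX q_diag [x * _]mulrC.
Qed.

(** The modulus of p(a) - w is that of the leading coefficient times the
    product of the distances from a to the preimages of w, so these cannot all
    be at distance r or more. *)
Lemma poly_root_near {K : numClosedFieldType} (p : {poly K}) (a r w : K) :
  (1 < size p)%N -> 0 < r ->
  `|p.[a] - w| < `|lead_coef p| * r ^+ (size p).-1 ->
  exists2 z, p.[z] = w & `|a - z| < r.
Proof.
move=> p_gt1 r_gt0 aw.
have szpw : size (p - w%:P) = size p.
  by rewrite size_polyDl // size_polyN (leq_ltn_trans (size_polyC_leq1 _)).
have lcpw : lead_coef (p - w%:P) = lead_coef p.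
  by rewrite lead_coefDl // size_polyN (leq_ltn_trans (size_polyC_leq1 _)).
have [s pwE] := closed_field_poly_normal (p - w%:P).
rewrite lcpw in pwE.
have lc0 : lead_coef p != 0.
  by rewrite lead_coef_eq0 -size_poly_gt0 (leq_trans _ p_gt1).
have szs : size s = (size p).-1.
  by rewrite -szpw pwE size_scale // size_prod_XsubC.
have [/hasP[z zs az]|/hasPn far] := boolP (has (fun z => `|a - z| < r) s).
  exists z => //; apply/eqP.
  rewrite -subr_eq0 -[w](hornerC w z) -hornerN -hornerD.
  by rewrite pwE hornerZ mulf_eq0 -rootE root_prod_XsubC zs orbT.
suff : `|lead_coef p| * r ^+ (size p).-1 <= `|p.[a] - w|.
  by move/le_lt_trans => /(_ _ aw); rewrite ltxx.
rewrite -[w in leRHS](hornerC w a) -hornerN -hornerD pwE hornerZ normrM.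
rewrite ler_pM2l ?normr_gt0 // horner_prod normr_prod -szs.
rewrite -iter_mulr_1 -count_predT -big_const_seq big_seq [leRHS]big_seq.
apply: ler_prod => z zs; rewrite ltW //= hornerXsubC real_leNgt ?far //.
exact: gtr0_real.
Qed.

(** On a ball M around a, the divided difference q of p is bounded away from
    0, which makes p injective there; [poly_root_near] provides the preimages.
    The inverse is Lipschitz by the lower bound on q, and its derivative at w is
    the inverse of the value of q on the diagonal. *)
Lemma poly_local_inverse {K : numClosedFieldType} (p : {poly K}) (a : K) :
  p^`().[a] != 0 ->
  exists (M V : set K) (mu : K -> K),
    [/\ open M, open V, M a /\ V p.[a],
        forall w, V w -> [/\ M (mu w), p.[mu w] = w & differentiable mu w]
      & forall z, M z -> V p.[z] -> mu p.[z] = z].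
Proof.
move=> dp_neq0.
have [q [q_cont qE q_diag]] := divided_difference p.
have [r r_gt0 q_big] : exists2 r : K, 0 < r &
    forall x y, ball a r x -> ball a r y -> `|p^`().[a]| / 2 < `|q (x, y)|.
  have : \forall z \near (a, a), `|p^`().[a]| / 2 < `|q z|.
    have : q z @[z --> (a, a)] --> p^`().[a] by rewrite -q_diag; exact: q_cont.
    move=> /cvgr_norm_gt; apply.
    by rewrite /= ltr_pdivrMr ?ltr_pMr ?normr_gt0 // ltr1n.
  move=> /nbhs_ballP[r /= r_gt0 rq]; exists r => // x y ax ay.
  by apply: rq; split.
have p_gt1 : (1 < size p)%N.
  rewrite ltnNge; apply: contra dp_neq0 => /size1_polyC ->.
  by rewrite derivC horner0.
pose e := `|lead_coef p| * r ^+ (size p).-1.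
have e_gt0 : 0 < e.
  rewrite mulr_gt0 ?exprn_gt0 // normr_gt0 lead_coef_eq0 -size_poly_gt0.
  exact: leq_trans p_gt1.
have root_in w : exists z, ball p.[a] e w -> p.[z] = w /\ ball a r z.
  have [aw|] := pselect (ball p.[a] e w); last by exists 0.
  by have [z zw az] := poly_root_near p a r w p_gt1 r_gt0 aw; exists z.
have [mu muP] := choice root_in.
have q_neq0 x y : ball a r x -> ball a r y -> q (x, y) != 0.
  move=> ax ay; rewrite -normr_gt0; apply: le_lt_trans (q_big _ _ ax ay).
  by rewrite divr_ge0.
exists (ball a r), (ball p.[a] e), mu; split.
- exact: ball_open.
- exact: ball_open.
- by split; apply: ballxx.
- move=> w aw; have [muw amuw] := muP w aw; split=> //.
  have near_w : \forall w' \near w, ball p.[a] e w'.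
    by apply: open_nbhs_nbhs; split=> //; exact: ball_open.
  have mu_cont : mu w' @[w' --> w] --> mu w.
    apply/(pseudometric_normed_Zmodule.cvgrPdist_lt (F := nbhs (w : K))).
    move=> d d_gt0; near=> w'.
    have [muw' amuw'] : p.[mu w'] = w' /\ ball a r (mu w').
      by apply: muP; near: w'.
    have : `|w - w'| < d * (`|p^`().[a]| / 2).
      near: w'; apply: (@nbhsx_ballx K K w).
      by rewrite mulr_gt0 ?divr_gt0 ?normr_gt0.
    have -> : w - w' = (mu w - mu w') * q (mu w, mu w').
      by rewrite -qE muw muw'.
    rewrite normrM; apply: contraTT.
    rewrite -!real_leNgt ?realM ?normr_real ?realV ?gtr0_real // => d_le.
    by apply: ler_pM => //; [exact: ltW|exact/ltW/q_big].
  apply/derivable1_diffP/cvg_ex; exists (q (mu w, mu w))^-1.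
  have shift_cvg : h *: 1 + w @[h --> (0 : K)^'] --> w.
    rewrite -[X in _ --> X]add0r -[X in _ --> X + _](scale0r 1).
    by apply: cvgD; [apply: cvgZr_tmp; exact: cvg_within|exact: cvg_cst].
  have mu_shift : mu (h *: 1 + w) @[h --> (0 : K)^'] --> mu w.
    exact: cvg_comp shift_cvg mu_cont.
  have : (q (mu (h *: 1 + w), mu w))^-1 @[h --> (0 : K)^'] -->
         (q (mu w, mu w))^-1.
    apply: cvgV; first exact: q_neq0.
    apply: (cvg_comp (fun h : K => (mu (h *: 1 + w), mu w)) q); last first.
      exact: q_cont.
    exact: cvg_pair mu_shift (cvg_cst _).
  apply: cvg_trans; apply: near_eq_cvg; near=> h => /=.
  have h_neq0 : h != 0 by near: h; exact: (@nbhs_dnbhs_neq K 0).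
  have [muh amuh] : p.[mu (h *: 1 + w)] = h *: 1 + w /\
      ball a r (mu (h *: 1 + w)).
    by apply: muP; near: h; exact: (shift_cvg _ near_w).
  have := qE (mu (h *: 1 + w)) (mu w).
  have hA : h *: 1 = h :> K by exact: mulr1.
  rewrite muh muw addrK {1}hA => hE.
  have q0 := q_neq0 _ _ amuh amuw.
  apply: (mulfI h_neq0); rewrite [in RHS]/GRing.scale /= mulVKf //.
  by rewrite {1}hE mulfK.
- move=> z az apz; have [pmu amu] := muP _ apz.
  apply/eqP; rewrite -subr_eq0; apply/eqP.
  have := qE (mu p.[z]) z; rewrite pmu subrr => /esym/eqP.
  by rewrite mulf_eq0 (negbTE (q_neq0 _ _ _ _)) // orbF => /eqP.
Unshelve. all: by end_near. Qed.

Lemma local_sqrt {K : numClosedFieldType} (c : K) : c != 0 ->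
  exists (V : set K) (sigma : K -> K), [/\ open V, V c &
    forall w, V w ->
      [/\ sigma w ^+ 2 = w, sigma w != 0 & differentiable sigma w]].
Proof.
move=> c_neq0.
have [] := poly_local_inverse 'X^2 (sqrtC c).
  by rewrite derivXn hornerMn hornerXn expr1 mulrn_eq0 sqrtC_eq0.
move=> M [V [sigma [_ oV [_ Vc] sigmaP _]]].
rewrite hornerXn sqrtCK in Vc.
exists (V `&` ~` [set 0]), sigma; split => [||w [Vw w0]].
- apply: openI => //; apply: closed_openC; apply: accessible_closed_set1.
  exact: hausdorff_accessible (@norm_hausdorff K K).
- by split=> // /eqP; apply/negP.
have [_ sqw dw] := sigmaP w Vw; rewrite hornerXn in sqw.
split=> //; apply/negP => /eqP s0; apply: w0.
by rewrite /= -sqw s0 expr0n.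
Qed.

Lemma cubic_local_inverse {K : numClosedFieldType} (t : K) : t != 0 ->
  exists (M V : set K) (mu : K -> K),
    [/\ open M, open V, V 0 /\ mu 0 = 0,
        forall b, V b ->
          [/\ M (mu b), mu b ^+ 3 - t * mu b = b & differentiable mu b]
      & forall m, M m -> V (m ^+ 3 - t * m) -> mu (m ^+ 3 - t * m) = m].
Proof.
move=> t_neq0; pose p : {poly K} := 'X^3 - t *: 'X.
have pE m : p.[m] = m ^+ 3 - t * m by rewrite !hornerE.
have [] := poly_local_inverse p 0.
  rewrite /p derivB derivXn derivZ derivX hornerD hornerN hornerMn hornerXn.
  by rewrite hornerZ hornerC expr0n mul0rn mulr1 sub0r oppr_eq0.
move=> M [V [mu [oM oV [M0 V0] muP muK]]].
have p0 : p.[0] = 0 by rewrite pE expr0n mulr0 subrr.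
exists M, V, mu; split=> //.
- by split; [rewrite -p0|rewrite -{1}p0 muK].
- by move=> b /muP[]; rewrite pE.
- by move=> m; rewrite -pE; exact: muK.
Qed.

(** * The last two coordinates and changes of variables adapted to them *)

Local Notation penult N := (inord N.-1 : 'I_N.+1) (only parsing).

Lemma val_penult N : penult N = N.-1 :> nat.
Proof. by rewrite inordK // ltnS leq_pred. Qed.

Lemma penult_neq_max {N} (hN : (1 <= N)%N) : penult N != ord_max.
Proof. by rewrite -val_eqE /= val_penult ltn_eqF // ltn_predL. Qed.

Lemma index_cases {N} (hN : (1 <= N)%N) (i : 'I_N.+1) :
  [\/ (i < N.-1)%N, i = penult N | i = ord_max].
Proof.
have [lti|] := ltnP i N.-1; first by constructor 1.
rewrite leq_eqVlt => /orP[/eqP ip|].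
  by constructor 2; apply/val_inj; rewrite /= val_penult.
rewrite prednK // => iN; constructor 3; apply/val_inj/eqP.
by rewrite eqn_leq iN -ltnS ltn_ord.
Qed.

Lemma index_lt {N} (i : 'I_N.+1) :
  (i < N.-1)%N -> (i == penult N = false) * (i == ord_max = false).
Proof.
move=> lti; split; rewrite -val_eqE /= ?val_penult ltn_eqF //.
exact: leq_trans lti (leq_pred N).
Qed.

(** All the changes of coordinates scale the first N - 1 coordinates by a
    common factor and replace the last two. *)
Definition adapted {K : numFieldType} {N} (c a b : K) (x : 'rV[K]_N.+1) :
    'rV[K]_N.+1 :=
  \row_i (if (i < N.-1)%N then c * x 0 i else if i == penult N then a else b).

Lemma adapted_penult {K : numFieldType} {N} (c a b : K) (x : 'rV[K]_N.+1) :
  adapted c a b x 0 (penult N) = a.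
Proof. by rewrite mxE val_penult // ltnn eqxx. Qed.

Lemma adapted_max {K : numFieldType} {N} (hN : (1 <= N)%N) (c a b : K)
    (x : 'rV[K]_N.+1) :
  adapted c a b x 0 ord_max = b.
Proof.
by rewrite mxE ltnNge leq_pred /= eq_sym (negbTE (penult_neq_max hN)).
Qed.

Lemma adapted_lt {K : numFieldType} {N} (c a b : K) (x : 'rV[K]_N.+1)
    (i : 'I_N.+1) : (i < N.-1)%N ->
  adapted c a b x 0 i = c * x 0 i.
Proof. by rewrite mxE => ->. Qed.

Lemma adapted_comp {K : numFieldType} {N} (c a b c' a' b' : K)
    (x : 'rV[K]_N.+1) :
  adapted c a b (adapted c' a' b' x) = adapted (c * c') a b x.
Proof.
apply/rowP => i; rewrite !mxE.
by case: (i < N.-1)%N; rewrite ?mulrA.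
Qed.

Lemma adapted_id {K : numFieldType} {N} (hN : (1 <= N)%N)
    (x : 'rV[K]_N.+1) :
  adapted 1 (x 0 (penult N)) (x 0 ord_max) x = x.
Proof.
apply/rowP => i; have [lti|->|->] := index_cases hN i.
- by rewrite adapted_lt // mul1r.
- by rewrite adapted_penult.
- by rewrite adapted_max.
Qed.

Lemma differentiable_adapted {K : numFieldType} {N} (hN : (1 <= N)%N)
    (c a b : 'rV[K]_N.+1 -> K) (x : 'rV[K]_N.+1) :
  differentiable c x -> differentiable a x -> differentiable b x ->
  differentiable (fun y => adapted (c y) (a y) (b y) y) x.
Proof.
move=> dc da db; apply: differentiable_row => i.
have [lti|ip|imax] := index_cases hN i.
- rewrite (_ : (fun y => _) = (fun y => c y * y 0 i)).
    by apply: differentiableM => //; exact: differentiable_coord.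
  by apply/funext => y; rewrite adapted_lt.
- rewrite ip (_ : (fun y => _) = a) //.
  by apply/funext => y; rewrite adapted_penult.
- rewrite imax (_ : (fun y => _) = b) //.
  by apply/funext => y; rewrite adapted_max.
Qed.

Lemma sum_sqr_adapted {K : numFieldType} {N} (c a b : K) (x : 'rV[K]_N.+1) :
  \sum_(i < N.+1 | (i < N.-1)%N) adapted c a b x 0 i ^+ 2 =
  c ^+ 2 * \sum_(i < N.+1 | (i < N.-1)%N) x 0 i ^+ 2.
Proof.
rewrite big_distrr; apply: eq_bigr => i lti.
by rewrite adapted_lt // exprMn.
Qed.

Lemma A_formE {R : realType} {N} (hN : (1 <= N)%N) m (y : 'AC[R]_N) :
  A_form m y =
  \sum_(i < N.+1 | (i < N.-1)%N) y 0 i ^+ 2 + y 0 (penult N) ^+ 2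
  + y 0 ord_max ^+ m.+1.
Proof.
congr (_ + _).
rewrite (bigD1 (penult N)) /=; last by rewrite val_penult // ltn_predL.
rewrite addrC; congr (_ + _); apply: eq_bigl => i.
have [lti|->|->] := index_cases hN i.
- by rewrite lti index_lt // (leq_trans lti) // leq_pred.
- by rewrite eqxx andbF val_penult // ltnn.
- by rewrite ltnn /= ltnNge leq_pred.
Qed.

(** * Singular points of the family *)

Lemma is_derive_family {K : numFieldType} {V : normedModType K} (s a b : V -> K)
    (t : K) (x v : V) (ds da db : K) :
  is_derive x v s ds -> is_derive x v a da -> is_derive x v b db ->
  is_derive x v (fun y => s y + a y ^+ 3 + b y ^+ 4 + t ^+ 2 * a y ^+ 2
                          + 2 * t * a y * b y ^+ 2)
    (ds + (3 * a x ^+ 2 + 2 * t * (t * a x + b x ^+ 2)) * da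
     + 4 * b x * (t * a x + b x ^+ 2) * db).
Proof.
move=> s' a' b'.
have -> : (fun y => s y + a y ^+ 3 + b y ^+ 4 + t ^+ 2 * a y ^+ 2
                   + 2 * t * a y * b y ^+ 2) =
    s + a ^+ 3 + b ^+ 4 + cst (t ^+ 2) * a ^+ 2 + cst (2 * t) * a * b ^+ 2.
  by apply/funext => y; rewrite !exprfctE.
have a2 := is_deriveM (is_derive_cst (t ^+ 2) x v) (is_deriveX 2 a').
have ab :=
  is_deriveM (is_deriveM (is_derive_cst (2 * t) x v) a') (is_deriveX 2 b').
have d := is_deriveD (is_deriveD (is_deriveD (is_deriveD s'
  (is_deriveX 3 a')) (is_deriveX 4 b')) a2) ab.
apply: (@is_derive_eq _ _ _ _ _ _ _ _ d).
rewrite /GRing.scale /= /cst !mulrfctE !exprfctE.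
ring.
Qed.

Lemma is_derive_sum_sqr {K : numFieldType} {n} (P : pred 'I_n.+1)
    (x v : 'rV[K]_n.+1) :
  is_derive x v (fun y : 'rV[K]_n.+1 => \sum_(i | P i) y 0 i ^+ 2)
    (\sum_(i | P i) 2 * x 0 i * v 0 i).
Proof.
have -> : (fun y : 'rV[K]_n.+1 => \sum_(i | P i) y 0 i ^+ 2) =
    \sum_(i < n.+1) (if P i then (fun y : 'rV[K]_n.+1 => y 0 i) ^+ 2 else 0).
  apply/funext => y; rewrite fct_sumE big_mkcond; apply: eq_bigr => i _.
  by case: ifP => // _; rewrite exprfctE.
rewrite [X in is_derive _ _ _ X]big_mkcond.
apply: is_derive_sum => i; case: ifP => _.
  have d := is_derive_coord x v i.
  by apply: is_derive_eq; rewrite expr1.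
exact: is_derive_cst.
Qed.

Lemma f_derivative {R : realType} {N} (t : Cplx R) (x v : 'AC[R]_N) :
  is_derive x v (@f_ R N t)
   (\sum_(i < N.+1 | (i < N.-1)%N) 2 * x 0 i * v 0 i
    + (3 * x 0 (penult N) ^+ 2
       + 2 * t * (t * x 0 (penult N) + x 0 ord_max ^+ 2)) * v 0 (penult N)
    + 4 * x 0 ord_max * (t * x 0 (penult N) + x 0 ord_max ^+ 2)
      * v 0 ord_max).
Proof.
exact: is_derive_family (is_derive_sum_sqr _ _ _) (is_derive_coord _ _ _)
  (is_derive_coord _ _ _).
Qed.

Lemma f_differentiable {R : realType} {N} (t : Cplx R) (x : 'AC[R]_N) :
  differentiable (@f_ R N t) x.
Proof.
rewrite /f_ /E6_form; differentiable_tac.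
rewrite (_ : (fun y => _) =
   \sum_(i < N.+1)
     (if (i < N.-1)%N then fun y : 'AC[R]_N => y 0 i ^+ 2 else 0)).
  apply: differentiable_sum => i; case: ifP => _.
    by apply: differentiable_pow; apply: differentiable_coord.
  exact: differentiable_cst.
apply/funext => y; rewrite fct_sumE big_mkcond; apply: eq_bigr => i _.
by case: ifP.
Qed.

(** The hypotheses say that g = a^3 + (t a + b^2)^2 and its derivatives in a and
    in b vanish. *)
Lemma critical_point_eq0 {K : numFieldType} (t a b : K) :
  a ^+ 3 + b ^+ 4 + t ^+ 2 * a ^+ 2 + 2 * t * a * b ^+ 2 = 0 ->
  3 * a ^+ 2 + 2 * t * (t * a + b ^+ 2) = 0 ->
  4 * b * (t * a + b ^+ 2) = 0 -> a = 0 /\ b = 0.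
Proof.
move=> f0 fa0 fb0.
have f0' : a ^+ 3 + (t * a + b ^+ 2) ^+ 2 = 0 by rewrite -f0; ring.
have [ab0|ab_neq0] := eqVneq (t * a + b ^+ 2) 0.
  have a0 : a = 0.
    move: f0'; rewrite ab0 expr0n addr0 => /eqP.
    by rewrite expf_eq0 => /eqP.
  split=> //; move/eqP: ab0; rewrite a0 mulr0 add0r.
  by rewrite expf_eq0 => /eqP.
have b0 : b = 0.
  by move/eqP: fb0; rewrite !mulf_eq0 (negbTE ab_neq0) pnatr_eq0 orbF => /eqP.
split=> //; have [//|a_neq0] := eqVneq a 0.
move: f0' fa0; rewrite b0 expr0n addr0 => f0' fa0.
have e1 : a + t ^+ 2 = 0.
  by apply: (mulfI (expf_neq0 2 a_neq0)); rewrite mulr0 -f0'; ring.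
have e2 : 3 * a + 2 * t ^+ 2 = 0.
  by apply: (mulfI a_neq0); rewrite mulr0 -fa0; ring.
have -> : a = (3 * a + 2 * t ^+ 2) - 2 * (a + t ^+ 2) by ring.
by rewrite e1 e2 mulr0 subrr.
Qed.

Lemma singular_pointsE {R : realType} {N} (hN : (1 <= N)%N) (t : Cplx R) :
  singular_points (@f_ R N t) = [set 0].
Proof.
apply/seteqP; split=> [x [fx dfx]|_ ->] /=; last first.
  split.
    rewrite /f_ /E6_form big1 => [|i _]; rewrite !mxE ?expr0n //=.
    by rewrite !mulr0 !addr0.
  apply: DiffDef; first exact: f_differentiable.
  apply/funext => v; rewrite -deriveE; last exact: f_differentiable.
  rewrite (@derive_val _ _ _ _ _ _ _ (f_derivative t 0 v)).
  by rewrite big1 => [|i _]; rewrite !mxE ?expr0n /= !(mulr0, mul0r, addr0).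
have grad v := esym (@derive_val _ _ _ _ _ _ _ (f_derivative t x v)).
have der0 v : 'D_v (@f_ R N t) x = 0.
  by rewrite deriveE ?diff_val //; exact: f_differentiable.
have {}grad v := etrans (grad v) (der0 v).
have sq0 (i : 'I_N.+1) : (i < N.-1)%N -> x 0 i = 0.
  move=> lti; have := grad (delta_mx 0 i).
  rewrite (bigD1 i) //= big1 ?mxE ?eqxx; last first.
    by move=> j /andP[_ ji]; rewrite mxE eqxx (negbTE ji) mulr0.
  rewrite ![_ == i]eq_sym !index_lt // !mulr0 !addr0 mulr1 => /eqP.
  by rewrite mulf_eq0 pnatr_eq0 => /eqP.
have sum0 (v : 'AC[R]_N) :
    \sum_(i < N.+1 | (i < N.-1)%N) 2 * x 0 i * v 0 i = 0.
  by apply: big1 => i lti; rewrite sq0 // mulr0 mul0r.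
have := grad (delta_mx 0 (penult N)); have := grad (delta_mx 0 ord_max).
rewrite !sum0 !mxE !eqxx [ord_max == _]eq_sym (negbTE (penult_neq_max hN)).
rewrite !mulr0 !mulr1 !addr0 !add0r => fb fa.
have [|a0 b0] := critical_point_eq0 t (x 0 (penult N)) (x 0 ord_max) _ fa fb.
  by rewrite -fx /f_ /E6_form big1 ?add0r // => i lti; rewrite sq0 // expr0n.
apply/rowP => i; rewrite mxE.
by case: (index_cases hN i) => [/sq0|->|->].
Qed.

(** * Equivalence with the A_5 normal form *)

(** The left-hand side is g at b = m^3 - t m. *)
Lemma family_factorization {K : numFieldType} (t a m : K) :
  a ^+ 3 + (m ^+ 3 - t * m) ^+ 4 + t ^+ 2 * a ^+ 2
    + 2 * t * a * (m ^+ 3 - t * m) ^+ 2 =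
  (a + (m ^+ 2 - t) ^+ 2) *
  ((a + t * m ^+ 2 - m ^+ 4 / 2) ^+ 2 + (3 / 4 * m ^+ 2 - t) * m ^+ 6).
Proof. by field. Qed.

Lemma hypersurface_germ_equiv_refl {R : realType} {N} (f : 'AC[R]_N -> Cplx R) :
  hypersurface_germ_equiv f 0 f.
Proof.
exists setT, setT, id, id, (cst 1); split=> //.
- by split=> //; split=> //; exact: openT.
- split; first exact: openT.
  by move=> x _; exact: differentiable_cst.
- by move=> x _; rewrite oner_neq0 mul1r.
Qed.

(** The local inverse mu of m^3 - t m turns b into m.  Dividing A by a square
    root rk of k and the first N - 1 coordinates by a square root ru of u makes
    u a common factor of all the terms of f_t. *)
Lemma family_equiv_A5 {R : realType} {N} (hN : (1 <= N)%N) (t : Cplx R) :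
  t != 0 ->
  hypersurface_germ_equiv (@f_ R N t) 0 (@A_form R N 5).
Proof.
move=> t_neq0.
have [M [V [mu [oM oV [V0 mu0] muP muK]]]] := cubic_local_inverse t t_neq0.
pose k (m : Cplx R) : Cplx R := 3 / 4 * m ^+ 2 - t.
pose u (a m : Cplx R) : Cplx R := (a + (m ^+ 2 - t) ^+ 2) * k m.
pose A (a m : Cplx R) : Cplx R := a + t * m ^+ 2 - m ^+ 4 / 2.
pose A' (a m : Cplx R) : Cplx R := a - t * m ^+ 2 + m ^+ 4 / 2.
have k0 : k 0 = - t by rewrite /k expr0n mulr0 sub0r.
have u0 : u 0 0 = - t ^+ 3 by rewrite /u k0; ring.
have k0_neq0 : k 0 != 0 by rewrite k0 oppr_eq0.
have u0_neq0 : u 0 0 != 0 by rewrite u0 oppr_eq0 expf_neq0.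
have [Vk [rk [oVk Vk0 rkP]]] := local_sqrt (k 0) k0_neq0.
have [Vu [ru [oVu Vu0 ruP]]] := local_sqrt (u 0 0) u0_neq0.
pose p : 'I_N.+1 := penult N.
pose q : 'I_N.+1 := ord_max.
(* U collects the conditions under which mu, rk and ru are evaluated inside
   their domains.  In the new coordinates y these are the conditions defining
   U', once y 0 q is required to be in the range M of mu. *)
pose U1 := [set x : 'AC[R]_N | V (x 0 q)].
pose U2 := U1 `&` [set x | Vk (k (mu (x 0 q)))].
pose U := U2 `&` [set x | Vu (u (x 0 p) (mu (x 0 q)))].
(* The old coordinate a as a function of the new coordinates. *)
pose a' (y : 'AC[R]_N) := A' (rk (k (y 0 q)) * y 0 p) (y 0 q).
pose U'1 := [set y : 'AC[R]_N | M (y 0 q)] `&`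
            [set y | V (y 0 q ^+ 3 - t * y 0 q)].
pose U'2 := U'1 `&` [set y | Vk (k (y 0 q))].
pose U' := U'2 `&` [set y | Vu (u (a' y) (y 0 q))].
pose phi (x : 'AC[R]_N) := let m := mu (x 0 q) in
  adapted (ru (u (x 0 p) m))^-1 ((rk (k m))^-1 * A (x 0 p) m) m x.
pose psi (y : 'AC[R]_N) := let m := y 0 q in
  adapted (ru (u (a' y) m)) (a' y) (m ^+ 3 - t * m) y.
have dx i (x : 'AC[R]_N) := differentiable_coord x 0 i.
have dmu x : U1 x -> differentiable (fun x : 'AC[R]_N => mu (x 0 q)) x.
  by move=> /muP[_ _]; exact: differentiable_comp (dx q x).
have dkm x : U1 x -> differentiable (fun x : 'AC[R]_N => k (mu (x 0 q))) x.
  by move=> /dmu ?; differentiable_tac.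
have dum x : U1 x ->
    differentiable (fun x : 'AC[R]_N => u (x 0 p) (mu (x 0 q))) x.
  by move=> Ux; have := dkm x Ux; have := dmu x Ux => ? ?; differentiable_tac.
have oU1 : open U1.
  rewrite -[U1]setTI.
  exact: (open_setI_preimage setT _ _ openT (fun x _ => dx q x) oV).
have oU2 : open U2 by exact: (open_setI_preimage U1 _ _ oU1 dkm oVk).
have oU : open U.
  exact: (open_setI_preimage U2 _ _ oU2 (fun x U2x => dum x U2x.1) oVu).
have dk (y : 'AC[R]_N) : differentiable (fun y : 'AC[R]_N => k (y 0 q)) y.
  by differentiable_tac.
have drk (y : 'AC[R]_N) : Vk (k (y 0 q)) ->
    differentiable (fun y : 'AC[R]_N => rk (k (y 0 q))) y.
  by move=> /rkP[_ _]; exact: differentiable_comp (dk y).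
have da' y : U'2 y -> differentiable a' y.
  by move=> [_ /drk ?]; differentiable_tac.
have oU'1 : open U'1.
  have oM' := open_setI_preimage setT _ _ openT (fun x _ => dx q x) oM.
  rewrite setTI in oM'.
  apply: (open_setI_preimage _ _ _ oM' _ oV) => y _.
  by differentiable_tac.
have oU'2 : open U'2.
  exact: (open_setI_preimage U'1 _ _ oU'1 (fun y _ => dk y) oVk).
have du' y : U'2 y -> differentiable (fun y => u (a' y) (y 0 q)) y.
  by move=> /da' ?; have ? := dk y; differentiable_tac.
have oU' : open U' by exact: (open_setI_preimage U'2 _ _ oU'2 du' oVu).
have holo_phi x : U x -> differentiable phi x.
  move=> [[U1x Ukx] Uux].
  have [_ ru_neq0 dru] := ruP _ Uux.
  have [_ rk_neq0 drkx] := rkP _ Ukx.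
  have dm := dmu x U1x.
  apply: (differentiable_adapted hN); last exact: dm.
    exact: differentiable_inv _ _ (differentiable_comp (dum x U1x) dru) ru_neq0.
  apply: differentiableM; last by differentiable_tac.
  exact: differentiable_inv _ _ (differentiable_comp (dkm x U1x) drkx) rk_neq0.
have holo_psi y : U' y -> differentiable psi y.
  move=> [U'2y Uuy]; have [_ _ dru] := ruP _ Uuy.
  apply: (differentiable_adapted hN); last by differentiable_tac.
    exact: (differentiable_comp (du' y U'2y) dru).
  exact: da'.
exists U, U', phi, psi, (fun x => u (x 0 p) (mu (x 0 q))); split.
- by do !split; rewrite /U1 /= ?mxE ?mu0.
- have A00 : A 0 0 = 0 by rewrite /A; ring.
  rewrite /phi !mxE mu0 A00 mulr0; apply/rowP => i; rewrite !mxE mulr0.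
  by case: ifP => // _; case: ifP.
- split; [by split| by split | |].
  + move=> x [[U1x Ukx] Uux].
    have [Mm mE _] := muP _ U1x.
    have [_ rk_neq0 _] := rkP _ Ukx; have [_ ru_neq0 _] := ruP _ Uux.
    have phi_q : phi x 0 q = mu (x 0 q) by rewrite /phi (adapted_max hN).
    have a'E : a' (phi x) = x 0 p.
      by rewrite /a' phi_q /phi adapted_penult mulVKf // /A' /A; ring.
    split.
      by do !split; rewrite /= ?a'E phi_q // mE.
    by rewrite /psi a'E phi_q mE /phi adapted_comp divff // (adapted_id hN).
  + move=> y [[[My Vy] Vky] Vuy].
    have [_ rk_neq0 _] := rkP _ Vky; have [_ ru_neq0 _] := ruP _ Vuy.
    have psi_p : psi y 0 p = a' y by rewrite /psi adapted_penult.
    have psi_q : psi y 0 q = y 0 q ^+ 3 - t * y 0 q.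
      by rewrite /psi (adapted_max hN).
    have mu_psi : mu (psi y 0 q) = y 0 q by rewrite psi_q muK.
    split.
      by do !split; rewrite /U1 /= ?psi_p ?mu_psi ?psi_q.
    have AE : (rk (k (y 0 q)))^-1 * A (a' y) (y 0 q) = y 0 p.
      have -> : A (a' y) (y 0 q) = rk (k (y 0 q)) * y 0 p.
        by rewrite /a' /A /A'; ring.
      by rewrite mulKf.
    by rewrite /phi psi_p mu_psi AE /psi adapted_comp mulVf //
      (adapted_id hN).
- by split; [exact: oU|move=> x [[U1x _] _]; exact: dum].
- move=> x [[U1x Ukx] Uux].
  have [_ mE _] := muP _ U1x.
  have [rk2 rk_neq0 _] := rkP _ Ukx; have [ru2 ru_neq0 _] := ruP _ Uux.
  split; first by rewrite -ru2 expf_neq0.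
  rewrite (A_formE hN) /phi sum_sqr_adapted adapted_penult (adapted_max hN).
  rewrite exprMn !exprVn ru2 rk2.
  set m := mu (x 0 q) in mE ru2 rk2 *.
  have u_neq0 : u (x 0 p) m != 0 by rewrite -ru2 expf_neq0.
  have k_neq0 : k m != 0 by rewrite -rk2 expf_neq0.
  rewrite !mulrDr mulVKf //.
  rewrite /f_ /E6_form -/q -mE -!addrA; congr (_ + _).
  rewrite !addrA family_factorization.
  rewrite /u -!mulrA [k m * (_ * _)]mulVKf //.
  by rewrite /A /k; ring.
Qed.


Theorem mainTheorem7 (R : realType) (N : nat) (hN : (1 <= N)%N) :
  of_type_E6 (@f_ R N 0) 0 /\
  generically (fun t : Cplx R =>
    singular_points (@f_ R N t) = [set 0] /\ of_type_A 5 (@f_ R N t) 0).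
Proof.
have isolated t : isolated_singular_point (@f_ R N t) 0.
  rewrite /isolated_singular_point singular_pointsE //; split=> //.
  exact: (@filterE _ (nbhs (0 : 'AC[R]_N))).
split.
  split=> //.
  have -> : @f_ R N 0 = @E6_form R N.
    by apply/funext => x; rewrite /f_ expr0n /= mulr0 !mul0r !addr0.
  exact: hypersurface_germ_equiv_refl.
exists 'X; first by rewrite polyX_eq0.
move=> t; rewrite hornerX => t_neq0; split; first exact: singular_pointsE.
by split=> //; exact: family_equiv_A5.
Qed.
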